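(* Let $n=1$, let $\mu$ be a Young diagram with $p_i\ge1$ for all $1\le i\le g$, and let $p\in{\mathcal P}(\mu)$. Write $T_\infty^t(p)=x_1(t)\otimes\cdots\otimes x_L(t)$ and identify $x_k(t)$ with the number $0$ or $1$ according as the $k$th letter is $1$ or $2$. Let ${\mathcal N}_\infty$ be the dynamical period of $p$ under $T_\infty$, i.e. the smallest positive integer with $T_\infty^{{\mathcal N}_\infty}(p)=p$. Then for every $1\le k\le L$, $$\frac{1}{{\mathcal N}_\infty}\sum_{t=0}^{{\mathcal N}_\infty-1}x_k(t)=\rho,\qquad \rho=\frac{|\mu|}{L}.$$
   Context: Fix $L\ge1$ and $n=1$. For $l\ge1$ let $B^{1,l}$ be the set of one-row semistandard tableaux of length $l$ with entries in $\{1,2\}$; $B^{1,1}=\{1,2\}$. For a semistandard tableau $T$ and a letter $x$, $T\leftarrow x$ denotes Schensted row insertion ($x$ bumps the smallest entry of the first row strictly larger than $x$, the bumped entry is inserted into the next row, and so on; if there is no such entry the letter is appended at the end of the row), and $x\rightarrow T$ denotes column insertion ($x$ bumps the smallest entry of the first column that is $\ge x$, the bumped entry is inserted into the next column, and so on; if there is no such entry the letter is appended at the bottom of the column). The combinatorial $R$ is the bijection $B^{1,l}\otimes B^{1,1}\to B^{1,1}\otimes B^{1,l}$, $b\otimes c\simeq c'\otimes b'$ iff $(c\rightarrow b)=(b'\leftarrow c')$ ($\otimes$ is a formal Cartesian product). The local energy $H(b\otimes c)$ is $0$ if this common tableau has shape $(l+1)$ and $1$ if it has shape $(l,1)$. A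 path is $p=b_1\otimes\cdots\otimes b_L\in(B^{1,1})^{\otimes L}$. For $v\in B^{1,l}$ put $v_0=v$ and $v_{k-1}\otimes b_k\simeq b'_k\otimes v_k$, $e_k=H(v_{k-1}\otimes b_k)$. The path $p$ is $T_l$-evolvable if there is $v$ with $v_L=v$ and $b'_1\otimes\cdots\otimes b'_L$ and all $e_k$ are the same for all such $v$; then $T_l(p)=b'_1\otimes\cdots\otimes b'_L$ and $E_l(p)=\sum_ke_k$. It is evolvable if it is $T_l$-evolvable for all $l\ge1$. $T_\infty$ denotes $T_l$ with $l$ sufficiently large. For a Young diagram $\mu$, let $l_1>\cdots>l_g\ge1$ be its distinct row lengths, $m_i$ the number of rows of length $l_i$, $|\mu|=\sum_il_im_i$, and $p_i=L-2\sum_{j=1}^g\min(l_i,l_j)m_j$. ${\mathcal P}(\mu)$ is the set of evolvable paths with at least as many letters $1$ as letters $2$ and with $E_l(p)=\sum_{i=1}^g\min(l,l_i)m_i$ for all $l\ge1$. *)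

(* Defs.v *)
(* Letters are the naturals 1 and 2; rows and paths are sequences of letters. *)
From HB Require Import structures.
From mathcomp Require Import all_boot all_order all_algebra.
Set Implicit Arguments.
Unset Strict Implicit.
Unset Printing Implicit Defensive.

(* A tableau is the sequence of its rows; [transpose] turns it into the
   sequence of its columns, and back. *)
Definition tableau := seq (seq nat).

Definition transpose (T : tableau) : tableau :=
  [seq [seq nth 0 r j | r <- T & j < size r] | j <- iota 0 (size (head [::] T))].

(* [x] bumps the first entry [y] of the first line with [bumps x y].  Lines of
   a semistandard tableau are sorted, so the first one is the smallest one. *)
Fixpoint insert_lines (bumps : rel nat) (x : nat) (T : tableau) : tableau :=
  if T is r :: T' then
    let i := find (bumps x) r in
    if i < size r then set_nth 0 r i x :: insert_lines bumps (nth 0 r i) T'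
    else rcons r x :: T'
  else [:: [:: x]].

Definition row_insert (T : tableau) (x : nat) : tableau :=
  insert_lines ltn x T.

Definition col_insert (x : nat) (T : tableau) : tableau :=
  transpose (insert_lines leq x (transpose T)).

Definition is_letter (x : nat) : bool := x \in [:: 1; 2].

(* The set B^{1,l}; a one-row tableau is represented by its only row. *)
Definition is_row (l : nat) (b : seq nat) : bool :=
  [&& size b == l, all is_letter b & sorted leq b].

Definition is_path (L : nat) (p : seq nat) : bool :=
  (size p == L) && all is_letter p.

(* b (x) c ~ c' (x) b', for b, b' in B^{1,l} and c, c' in B^{1,1}. *)
Definition comb_R (l : nat) (b : seq nat) (c c' : nat) (b' : seq nat) : Prop :=
  [/\ is_row l b, is_letter c, is_letter c', is_row l b' &
      col_insert c [:: b] = row_insert [:: b'] c'].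

Definition local_energy (b : seq nat) (c : nat) : nat :=
  shape (col_insert c [:: b]) == [:: size b; 1].

(* [carries l v p p' e w]: starting from v_0 = v, the carrier crosses
   p = b_1 ... b_L, leaving p' = b'_1 ... b'_L and e = e_1 ... e_L, and ends
   as v_L = w. *)
Inductive carries (l : nat) :
    seq nat -> seq nat -> seq nat -> seq nat -> seq nat -> Prop :=
| carries_nil v : is_row l v -> carries l v [::] [::] [::] v
| carries_cons v b b' v1 p p' e w :
    comb_R l v b b' v1 -> carries l v1 p p' e w ->
    carries l v (b :: p) (b' :: p') (local_energy v b :: e) w.

(* p is T_l-evolvable, with T_l(p) = p' and local energies e. *)
Definition evolves (l : nat) (p p' e : seq nat) : Prop :=
  (exists v, carries l v p p' e v) /\
  (forall v q f, carries l v p q f v -> q = p' /\ f = e).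

Definition evolvable (p : seq nat) : Prop :=
  forall l, 1 <= l -> exists p' e, evolves l p p' e.

(* The partial maps T_l, E_l and T_oo, as functional relations. *)
Definition T_eq (l : nat) (p q : seq nat) : Prop :=
  exists e, evolves l p q e.

Definition E_eq (l : nat) (p : seq nat) (s : nat) : Prop :=
  exists p' e, evolves l p p' e /\ s = sumn e.

Definition Tinf_eq (p q : seq nat) : Prop :=
  exists l0, forall l, l0 <= l -> T_eq l p q.

(* x t = T_oo^t(p) for all t; in particular all these iterates are defined. *)
Definition Tinf_orbit (p : seq nat) (x : nat -> seq nat) : Prop :=
  x 0 = p /\ forall t, Tinf_eq (x t) (x t.+1).

(* For x t = T_oo^t(p). *)
Definition dynamical_period (p : seq nat) (x : nat -> seq nat) (N : nat) : Prop :=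
  [/\ 0 < N, x N = p & forall M, 0 < M -> x M = p -> N <= M].

(* x_k(t), for 1 <= k. *)
Definition occupation (k : nat) (p : seq nat) : nat := nth 1 p k.-1 == 2.

(* A Young diagram is the sequence of its row lengths.  Then [undup mu] lists
   l_1 > ... > l_g, and m_i = count_mem l_i mu. *)
Definition young_diagram (mu : seq nat) : bool :=
  sorted geq mu && (0 \notin mu).

Definition weight (mu : seq nat) : nat :=
  \sum_(a <- undup mu) a * count_mem a mu.

Definition min_sum (mu : seq nat) (l : nat) : nat :=
  \sum_(a <- undup mu) minn l a * count_mem a mu.

(* p_i is [vacancy L mu l_i]; it may be negative. *)
Definition vacancy (L : nat) (mu : seq nat) (l : nat) : int :=
  (L%:Z - 2 * (min_sum mu l)%:Z)%R.

(* The set P(mu), for paths of length L. *)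
Definition calP (L : nat) (mu p : seq nat) : Prop :=
  [/\ is_path L p, evolvable p, count_mem 2 p <= count_mem 1 p &
      forall l, 1 <= l -> E_eq l p (min_sum mu l)].

(* Main.v *)
(* A carrier of large capacity is a load, the number of letters 2 it holds.
   Its final load is a max-plus affine function of the initial one, so when
   the letters 1 are in strict majority (as the vacancy hypothesis ensures,
   the energy at large l being the number of letters 2) it closes up for
   exactly one initial load.  T_oo is then a well-defined map that is inverted
   by running the carrier from right to left, hence its orbits are periodic.

   Locally, letters k and k+1 read "2 1" at time t if and only if they read
   "1 2" at time t+1.  Thus x_k(t) - x_(k+1)(t) = h(t+1) - h(t) where h(t) is 1
   if letters k and k+1 read "1 2" at time t and 0 otherwise, and summing over
   a period shows that the time average of x_k does not depend on k.  The
   number of letters 2, conserved and equal to |mu|, gives the common value. *)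
Require Import Defs.
From mathcomp Require Import all_boot all_order all_algebra.
From mathcomp Require Import zify.

Set Implicit Arguments.
Unset Strict Implicit.
Unset Printing Implicit Defensive.

(** * Dynamics of a carrier of infinite capacity *)

(* Letters 2 and 1 are [true] and [false]; the carrier has infinite capacity. *)
Definition next_load (x : bool) (u : nat) : nat := if x then u.+1 else u.-1.

Fixpoint final_load (s : seq bool) (u : nat) : nat :=
  if s is x :: s' then final_load s' (next_load x u) else u.

Fixpoint output (s : seq bool) (u : nat) : seq bool :=
  if s is x :: s' then (~~ x && (0 < u)) :: output s' (next_load x u) else [::].

(** One run of an empty carrier yields a load at which it can close up; a second run, from that
    load, gives the output. *)
Definition evolution (s : seq bool) : seq bool := output s (final_load s 0).

Lemma size_output s u : size (output s u) = size s.
Proof. by elim: s u => //= x s IHs u; rewrite IHs. Qed.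

Lemma count_output s u :
  count id (output s u) + final_load s u = count id s + u.
Proof.
elim: s u => [|x s IHs] u //=; have := IHs (next_load x u).
by case: x => /=; case: u => [|u] /=; lia.
Qed.

(** The load is a free walk until it is clipped at 0; there it meets the load started at 0, which
    never exceeds it, and the two stay equal. *)
Lemma final_load_max s u :
  final_load s u = maxn (u + count id s - count negb s) (final_load s 0).
Proof.
elim: s u => [|x s IHs] u /=; first lia.
rewrite (IHs (next_load x u)) (IHs (next_load x 0)).
by case: x => /=; lia.
Qed.

Lemma final_load_fixed s : count id s <= count negb s ->
  final_load s (final_load s 0) = final_load s 0.
Proof. by move=> le_s; rewrite final_load_max; lia. Qed.

(** The free-walk branch of the maximum lies strictly below any positive [u], so a fixed load must
    attain the other branch. *)
Lemma final_load_fixedE s u : count id s < count negb s ->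
  final_load s u = u -> u = final_load s 0.
Proof. by move=> lt_s; rewrite final_load_max; lia. Qed.

Lemma final_load_cat s1 s2 u :
  final_load (s1 ++ s2) u = final_load s2 (final_load s1 u).
Proof. by elim: s1 u => //=. Qed.

Lemma output_cat s1 s2 u :
  output (s1 ++ s2) u = output s1 u ++ output s2 (final_load s1 u).
Proof. by elim: s1 u => //= x s1 IHs u; rewrite IHs. Qed.

(** The local rule is an involution: applied to the emitted letter and the new load, it returns the
    letter read and the old load. *)
Lemma final_load_rev s u : final_load (rev (output s u)) (final_load s u) = u.
Proof.
elim: s u => //= x s IHs u; rewrite rev_cons -cats1 final_load_cat IHs.
by case: x; case: u.
Qed.

Lemma output_rev s u : output (rev (output s u)) (final_load s u) = rev s.
Proof.
elim: s u => //= x s IHs u.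
rewrite !rev_cons -!cats1 output_cat IHs final_load_rev.
by case: x; case: u.
Qed.

Lemma count_negb_id (s : seq bool) : count negb s + count id s = size s.
Proof. by elim: s => //= -[] s /=; lia. Qed.

Lemma size_evolution s : size (evolution s) = size s.
Proof. exact: size_output. Qed.

Lemma count_evolution s : count id s <= count negb s ->
  count id (evolution s) = count id s.
Proof.
move=> le_s; have := count_output s (final_load s 0).
by rewrite final_load_fixed // -/(evolution s); lia.
Qed.

(** Run backwards, the carrier closes up at the same load; by uniqueness this is the load that
    [evolution] uses on the reversed output. *)
Lemma evolution_rev s : count id s < count negb s ->
  evolution (rev (evolution s)) = rev s.
Proof.
move=> lt_s; rewrite {1}/evolution.
have fixs := final_load_fixed (ltnW lt_s).
have := final_load_rev s (final_load s 0); rewrite fixs -/(evolution s).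
move=> /final_load_fixedE <-.
  by rewrite -[in LHS]fixs /evolution output_rev.
rewrite !count_rev.
have := count_negb_id (evolution s); have := count_negb_id s.
by rewrite size_evolution (count_evolution (ltnW lt_s)); lia.
Qed.

(** A 2 loads the carrier, so a following 1 emits a 2. Conversely, a 2 emitted second is a 1 read
    under positive load; a 1 just before it would also have met a positive load and emitted 2. *)
Lemma output_01 s u k : k.+1 < size s ->
  nth false s k && ~~ nth false s k.+1 =
  ~~ nth false (output s u) k && nth false (output s u) k.+1.
Proof.
elim: s u k => [|x s IHs] u [|k] //= lt_k; last exact: IHs.
by case: s lt_k {IHs} => // y s _; case: x; case: y; case: u => [|[|u]].
Qed.

(** * Row tableaux, insertion and the combinatorial R *)

Definition letter (x : bool) : nat := if x then 2 else 1.

Definition row (l u : nat) : seq nat := nseq (l - u) 1 ++ nseq u 2.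

Lemma letterP c : is_letter c -> exists x, c = letter x.
Proof.
by rewrite /is_letter !inE => /orP[] /eqP->; [exists false | exists true].
Qed.

Lemma path_letters p : all is_letter p -> p = map letter (map (pred1 2) p).
Proof. by elim: p => //= c p IHp /andP[/letterP[[] ->] /IHp <-]. Qed.

Lemma sorted_row m n : sorted leq (nseq m 1 ++ nseq n 2).
Proof.
have path2 k : path leq 2 (nseq k 2) by elim: k.
case: m => [|m]; first by case: n.
by rewrite /=; elim: m => //=; case: n.
Qed.

Lemma is_rowP l b :
  reflect (exists2 u, u <= l & b = row l u) (is_row l b).
Proof.
apply: (iffP and3P) => [[/eqP <- letb sortb] | [u le_ul ->]].
  suff [m [n ->]] : exists m n, b = nseq m 1 ++ nseq n 2.
    exists n; rewrite ?size_cat ?size_nseq ?leq_addl //.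
    by rewrite /row addnK.
  elim: b letb sortb => [|c b IHb] /=; first by exists 0, 0.
  case/andP=> /letterP[x ->] letb pathb.
  have [m [n def_b]] := IHb letb (path_sorted pathb).
  case: x pathb => /= pathb; last by exists m.+1, n; rewrite def_b.
  exists 0, n.+1; rewrite def_b; congr cons.
  by case: m def_b => // m def_b; rewrite def_b in pathb.
rewrite size_cat !size_nseq subnK // all_cat !all_nseq !orbT.
by split=> //; exact: sorted_row.
Qed.

Lemma is_row_row l u : u <= l -> is_row l (row l u).
Proof. by move=> le_ul; apply/is_rowP; exists u. Qed.

Lemma transpose1 s : transpose [:: s] = [seq [:: y] | y <- s].
Proof.
rewrite /transpose /=; apply: (@eq_from_nth _ [::]) => [|i].
  by rewrite !size_map size_iota.
rewrite size_map size_iota => lt_i.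
by rewrite !(nth_map 0) ?size_iota // nth_iota //= add0n lt_i.
Qed.

Lemma transpose_singletons x s :
  transpose [seq [:: y] | y <- x :: s] = [:: x :: s].
Proof. by rewrite /transpose /=; do 2!congr cons; elim: s => //= y s ->. Qed.

Lemma transpose_hook x y s :
  transpose ([:: x; y] :: [seq [:: z] | z <- s]) = [:: x :: s; [:: y]].
Proof.
rewrite /transpose /=; congr [:: _ :: _; _ :: _]; first by elim: s => //= z s ->.
by elim: s.
Qed.

(** Each one-entry column is bumped in turn, so the row shifts one place to the right. *)
Lemma insert_lines_leq x s : path leq x s ->
  insert_lines leq x [seq [:: y] | y <- s] = [seq [:: y] | y <- x :: s].
Proof. by elim: s x => //= y s IHs x /andP[-> pathy]; rewrite /= IHs. Qed.

Lemma col_insert1 l u : col_insert 1 [:: row l u] = [:: 1 :: row l u].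
Proof.
rewrite /col_insert transpose1 insert_lines_leq ?transpose_singletons //.
exact: (sorted_row (l - u).+1 u).
Qed.

Lemma col_insert2 l u : u < l -> col_insert 2 [:: row l u] = [:: row l u; [:: 2]].
Proof.
move=> lt_ul; rewrite /col_insert transpose1 /row.
by rewrite -(subnSK lt_ul) /= transpose_hook.
Qed.

Lemma insert_lines_rcons (bumps : rel nat) x r T : ~~ has (bumps x) r ->
  insert_lines bumps x (r :: T) = rcons r x :: T.
Proof. by move=> /hasNfind /= ->; rewrite ltnn. Qed.

Lemma row_insert2 l u : row_insert [:: row l u] 2 = [:: rcons (row l u) 2].
Proof.
by rewrite /row_insert insert_lines_rcons // has_cat !has_nseq !andbF.
Qed.

Lemma row_insert1_0 l : row_insert [:: row l 0] 1 = [:: 1 :: row l 0].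
Proof.
rewrite /row_insert insert_lines_rcons ?has_cat ?has_nseq ?andbF //.
by rewrite /row cats0; congr cons; elim: (l - 0) => //= n ->.
Qed.

Lemma row_insert1 l u : u < l ->
  row_insert [:: row l u.+1] 1 = [:: row l u; [:: 2]].
Proof.
move=> lt_ul; rewrite /row_insert /= /row -(subnSK lt_ul).
elim: (l - u.+1) => [|m] //=.
by rewrite !ltnS; case: ifP => //= _ [-> ->].
Qed.

Lemma row_inj l : injective (row l).
Proof.
move=> u w /(congr1 (count_mem 2)).
by rewrite /row !count_cat !count_nseq !mul0n !mul1n.
Qed.

(** For [u <= l], the bound excludes only a full carrier meeting a 2. The shape and entries of the
    common tableau determine [c] and [b]. *)
Lemma comb_R_nonfull l u (x : bool) c b : u + x <= l ->
  comb_R l (row l u) (letter x) c b <->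
  c = letter (~~ x && (0 < u)) /\ b = row l (next_load x u).
Proof.
move=> le_l; split.
  case=> _ _ /letterP[y ->] /is_rowP[w le_wl ->].
  case: x le_l => le_l /=.
    rewrite col_insert2 ?row_insert2; last lia.
    case: y => /=; first by rewrite row_insert2.
    case: w le_wl => [|w] le_wl; first by rewrite row_insert1_0.
    by rewrite row_insert1 // => -[] /row_inj ->.
  rewrite col_insert1.
  case: y => /=.
    rewrite row_insert2 => -[] /(congr1 (count_mem 2)).
    rewrite -cats1 /= /row !count_cat !count_nseq /= !mul0n !mul1n.
    by case: u {le_l} => [|u] /= eq_u; [lia | have -> : u = w by lia].
  case: w le_wl => [|w] le_wl; last by rewrite row_insert1.
  by rewrite row_insert1_0 => -[] /row_inj ->.
case=> -> ->; split=> //; try (apply: is_row_row).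
- lia.
- by case: x {le_l}.
- by case: x u {le_l} => [] [].
- by case: x le_l; rewrite /next_load; lia.
case: x le_l => le_l /=.
  have lt_ul : u < l by lia.
  by rewrite col_insert2 ?row_insert1.
rewrite col_insert1; case: u le_l => [|u] le_l /=; first by rewrite row_insert1_0.
rewrite row_insert2 /row -cats1 -catA -[nseq u 2 ++ _](nseqD u 1).
by rewrite addn1 -(subnSK (m := u) (n := l)); last lia.
Qed.

Lemma local_energy_nonfull l u (x : bool) : u + x <= l ->
  local_energy (row l u) (letter x) = x.
Proof.
rewrite /local_energy; case: x => le_l.
  have lt_ul : u < l by lia.
  by rewrite col_insert2 //= eqxx.
by rewrite col_insert1 /= eqseq_cons andbF.
Qed.

(** * Carriers of large finite capacity *)

Lemma carries_output l s u : u + size s <= l ->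
  carries l (row l u) (map letter s) (map letter (output s u))
    (map nat_of_bool s) (row l (final_load s u)).
Proof.
elim: s u => [|x s IHs] u /= le_l.
  by apply: carries_nil; apply: is_row_row; lia.
have le_x : u + x <= l by case: x; lia.
rewrite -(local_energy_nonfull le_x); apply: carries_cons.
  exact/comb_R_nonfull.
by apply: IHs; case: x {le_x} => /=; lia.
Qed.

Lemma carries_nil_inv l v q e w : carries l v [::] q e w ->
  [/\ q = [::], e = [::] & w = v].
Proof. by move=> car; inversion car. Qed.

Lemma carries_cons_inv l v c p q e w : carries l v (c :: p) q e w ->
  exists c' v' q' e', [/\ q = c' :: q', e = local_energy v c :: e',
    comb_R l v c c' v' & carries l v' p q' e' w].
Proof.
by move=> car; inversion car as [|? ? c' v' ? q' e']; exists c', v', q', e'.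
Qed.

Lemma carries_inv l s u q e b : u + size s <= l ->
  carries l (row l u) (map letter s) q e b ->
  [/\ q = map letter (output s u), e = map nat_of_bool s &
      b = row l (final_load s u)].
Proof.
elim: s u q e => [|x s IHs] u q e /= le_l; first exact: carries_nil_inv.
have le_x : u + x <= l by case: x; lia.
case/carries_cons_inv=> c [v [q' [e' [-> ->]]]].
rewrite local_energy_nonfull // => /(comb_R_nonfull _ _ le_x)[-> ->] car.
by have [|-> -> ->] := IHs _ _ _ _ car; first by case: x {car le_x} => /=; lia.
Qed.

Lemma carries_row l v p q e w : carries l v p q e w -> is_row l v.
Proof. by elim=> // {v p q e w} v b b' v1 p p' e w []. Qed.

(** Carriers that fill up are included, so this bounds the load of a closed carrier before it is
    known to have room. *)
Lemma carries_le l s u q e w : u <= l ->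
  carries l (row l u) (map letter s) q e (row l w) -> w <= final_load s u.
Proof.
elim: s u q e => [|x s IHs] u q e /= le_ul.
  by case/carries_nil_inv=> _ _ /row_inj ->.
case/carries_cons_inv=> c [v [q' [e' [_ _ R1 car]]]].
have [u1 le_u1 def_v] := is_rowP _ _ (carries_row car).
rewrite def_v in R1 car; apply: leq_trans (IHs _ _ _ le_u1 car) _.
suff le_u1x : u1 <= next_load x u.
  by rewrite (final_load_max s (next_load x u)) (final_load_max s u1); lia.
case: (leqP (u + x) l) => [le_l|gt_l].
  by have [_ /row_inj ->] := (comb_R_nonfull _ _ le_l).1 R1.
by case: x gt_l {R1} => /=; lia.
Qed.

Lemma final_load_le s u : final_load s u <= u + size s.
Proof.
elim: s u => [|x s IHs] u /=; first lia.
by have := IHs (next_load x u); case: x => /=; lia.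
Qed.

Lemma evolves_uniq l p q q' e e' : evolves l p q e -> evolves l p q' e' ->
  q = q' /\ e = e'.
Proof. by case=> [] [v car] _ [_ uq]; apply: uq car. Qed.

(** Stated for a weak majority, because energies are read off before the strict one is available.
    Capacity [2 * size s] holds an initial load of at most [size s] and one more unit per letter. *)
Lemma carries_evolution l s : 2 * size s <= l -> count id s <= count negb s ->
  exists v, carries l v (map letter s) (map letter (evolution s))
    (map nat_of_bool s) v.
Proof.
move=> le_l le_s; exists (row l (final_load s 0)).
rewrite -{2}final_load_fixed //; apply: carries_output.
by have := final_load_le s 0; lia.
Qed.

Lemma evolves_evolution l s : 2 * size s <= l -> count id s < count negb s ->
  evolves l (map letter s) (map letter (evolution s)) (map nat_of_bool s).
Proof.
move=> le_l lt_s; split; first exact: carries_evolution (ltnW lt_s).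
move=> v q f car; have [u le_u def_v] := is_rowP _ _ (carries_row car); subst v.
(* Closing up gives [u <= final_load s u]; by strict majority this forces [u <= final_load s 0]. *)
have le_us : u <= size s.
  have := carries_le le_u car; rewrite final_load_max.
  by have := final_load_le s 0; lia.
have [|-> -> /row_inj fixu] := carries_inv _ car; first by lia.
by rewrite /evolution -(final_load_fixedE lt_s (esym fixu)).
Qed.

Lemma Tinf_evolution s q : count id s < count negb s ->
  Tinf_eq (map letter s) q <-> q = map letter (evolution s).
Proof.
move=> lt_s; split=> [[l0 ev_q] | ->].
  have [e ev_e] := ev_q (maxn l0 (2 * size s)) (leq_maxl _ _).
  by have [] := evolves_uniq ev_e (evolves_evolution (leq_maxr _ _) lt_s).
by exists (2 * size s) => l le_l; eexists; exact: evolves_evolution.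
Qed.

(** * The number of letters 2 and the vacancy condition *)

Lemma min_sum_weight mu l : (forall a, a \in mu -> a <= l) ->
  min_sum mu l = weight mu.
Proof.
move=> le_l; apply: eq_big_seq => a; rewrite mem_undup => /le_l le_al.
by rewrite (minn_idPr le_al).
Qed.

(** With enough capacity the local energy is 1 exactly at the letters 2, so their number is the
    energy at large [l]. *)
Lemma count_weight mu s : count id s <= count negb s ->
  (forall l, 1 <= l -> E_eq l (map letter s) (min_sum mu l)) ->
  count id s = weight mu.
Proof.
(* This [l] is positive, bounds every row of [mu] and leaves the carrier room. *)
move=> le_s; pose l := (maxn (\max_(a <- mu) a) (2 * size s)).+1.
move=> /(_ l isT)[q [e [[_ uq]]]].
rewrite min_sum_weight => [->|a mu_a]; last first.
  apply/leqW/(leq_trans (leq_bigmax_seq (P := predT) (F := id) _ mu_a isT)).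
  exact: leq_maxl.
have le_l : 2 * size s <= l by apply: leqW; exact: leq_maxr.
have [v /uq[_ <-]] := carries_evolution le_l le_s.
by rewrite sumnE big_map -sum1_count big_mkcond.
Qed.

(** The vacancy at the longest row, the head of [mu], is [L - 2|mu|], every minimum there being the
    other row's length. *)
Lemma weight_lt L mu : 1 <= L -> young_diagram mu ->
  (forall a : nat, a \in mu -> (1 <= vacancy L mu a)%R) -> 2 * weight mu < L.
Proof.
case: mu => [|a mu] L1 /andP[sort_mu _] vac.
  by rewrite /weight big_nil.
have := vac a (mem_head _ _); rewrite /vacancy min_sum_weight; first lia.
move=> b; rewrite inE => /predU1P[-> //|mu_b].
have geq_trans : transitive geq by move=> x y z /[swap]; exact: leq_trans.
by have /allP := order_path_min geq_trans sort_mu; exact.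
Qed.

(** * Periodicity and time averages *)

Lemma iter_evolution s t : count id s < count negb s ->
  [/\ size (iter t evolution s) = size s,
      count id (iter t evolution s) = count id s &
      count id (iter t evolution s) < count negb (iter t evolution s)].
Proof.
move=> lt_s; elim: t => //= t [size_t count_t lt_t].
have eq_count := count_evolution (ltnW lt_t).
split; rewrite ?size_evolution ?eq_count //.
have := count_negb_id (evolution (iter t evolution s)).
have := count_negb_id (iter t evolution s).
by rewrite size_evolution eq_count; lia.
Qed.

Lemma evolution_inj s s' :
  count id s < count negb s -> count id s' < count negb s' ->
  evolution s = evolution s' -> s = s'.
Proof.
move=> lt_s lt_s' eq_ss'; apply: (can_inj revK).
by rewrite -evolution_rev // eq_ss' evolution_rev.
Qed.

(** [evolution] is an injective self-map of the finite set of words of fixed length with a strict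
    majority of 1. *)
Lemma evolution_periodic s : count id s < count negb s ->
  exists2 N, 0 < N & iter N evolution s = s.
Proof.
move=> lt_s; pose L := size s.
have size_ev (y : L.-tuple bool) : size (evolution y) == L.
  by rewrite size_evolution size_tuple.
pose f (y : L.-tuple bool) := Tuple (size_ev y).
pose S := [pred y : L.-tuple bool | count id y < count negb y].
have fS : {homo f : y / y \in S}.
  by move=> y lt_y; have [] := iter_evolution 1 lt_y.
have injf : {in S &, injective f}.
  move=> y y' lt_y lt_y' /(congr1 val) /= eq_f; apply: val_inj.
  exact: evolution_inj eq_f.
have itf N : val (iter N f (in_tuple s)) = iter N evolution s.
  by elim: N => //= N ->.
exists (order f (in_tuple s)); first exact: order_gt0.
by rewrite -itf (iter_order_in fS injf).
Qed.

Lemma sum_nth_iter s N k : iter N evolution s = s -> k.+1 < size s ->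
  \sum_(0 <= t < N) nth false (iter t evolution s) k =
  \sum_(0 <= t < N) nth false (iter t evolution s) k.+1.
Proof.
move=> perN lt_k; pose h t :=
  ~~ nth false (iter t evolution s) k && nth false (iter t evolution s) k.+1.
(* Shifting time preserves the sum because [h N = h 0]. *)
have sumh : \sum_(0 <= t < N) h t.+1 = \sum_(0 <= t < N) h t :> nat.
  have : \sum_(0 <= t < N.+1) h t = h 0 + \sum_(0 <= t < N) h t.+1.
    exact: big_nat_recl.
  by rewrite big_nat_recr //= addnC {1}/h /= perN => /addnI.
(* With [h t.+1] read as the pattern 2 1 at time [t], both sides tell whether letter [k] or [k.+1]
   is a 2. *)
have step t : nth false (iter t evolution s) k + h t =
              nth false (iter t evolution s) k.+1 + h t.+1.
  rewrite {2}/h /= {3 4}/evolution -output_01.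
    by rewrite /h; do 2!case: (nth _ _ _).
  by elim: t => //= t; rewrite size_evolution.
apply/(@addIn (\sum_(0 <= t < N) h t)).
by rewrite -{2}sumh -!big_split /=; apply: eq_bigr.
Qed.

Lemma sum_nth_period s N k : count id s < count negb s ->
  iter N evolution s = s -> k < size s ->
  size s * \sum_(0 <= t < N) nth false (iter t evolution s) k =
  N * count id s.
Proof.
move=> lt_s perN lt_k; pose S k := \sum_(0 <= t < N) nth false (iter t evolution s) k.
have S0 j : j < size s -> S j = S 0.
  elim: j => // j IHj lt_j; rewrite -IHj; last exact: ltnW.
  by rewrite /S -sum_nth_iter.
(* Double counting: all positions have equal sums, and each time contributes the conserved number of
   letters 2. *)
transitivity (\sum_(0 <= j < size s) S j).
  rewrite -/(S k) S0 // (eq_big_nat _ _ (F2 := fun=> S 0)) => [|j /andP[_] /S0 //].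
  by rewrite sum_nat_const_nat subn0.
rewrite /S exchange_big /= (eq_big_nat _ _ (F2 := fun=> count id s)).
  by rewrite sum_nat_const_nat subn0.
move=> t _; have [size_t <- _] := iter_evolution t lt_s.
by rewrite -size_t -sum1_count [RHS]big_mkcond (big_nth false).
Qed.

Theorem proposition4p2 (L : nat) (mu p : seq nat)
    (hL : (1 <= L)%N) (hmu : young_diagram mu)
    (hvac : forall a : nat, a \in mu -> (1 <= vacancy L mu a)%R)
    (hp : calP L mu p) :
  (exists (x : nat -> seq nat) (N : nat),
     Tinf_orbit p x /\ dynamical_period p x N) /\
  (forall (x : nat -> seq nat) (N : nat),
     Tinf_orbit p x -> dynamical_period p x N ->
     forall k : nat, (1 <= k <= L)%N ->
     (N%:R^-1 * \sum_(0 <= t < N) (occupation k (x t))%:R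
        = (weight mu)%:R / L%:R :> rat)%R).
Proof.
have lt_L := weight_lt hL hmu hvac.
case: hp => /andP[/eqP size_p let_p] _.
rewrite (path_letters let_p); set s := map (pred1 2) p => le_p hE.
have size_s : size s = L by rewrite size_map.
have letter_inj : injective letter by do 2!case.
have count_s : count_mem 2 (map letter s) = count id s.
  by rewrite count_map; apply: eq_count; case.
have count_s' : count_mem 1 (map letter s) = count negb s.
  by rewrite count_map; apply: eq_count; case.
rewrite count_s count_s' in le_p.
have weight_s := count_weight le_p hE.
(* The letters 2 number [weight mu], less than half of [L]. *)
have lt_s : count id s < count negb s.
  by have := count_negb_id s; lia.
split.
  have [N0 N0_gt0 perN0] := evolution_periodic lt_s.
  have exN : exists N, (0 < N) && (iter N evolution s == s).
    by exists N0; rewrite N0_gt0 perN0 eqxx.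
  case: (ex_minnP exN) => N /andP[N_gt0 /eqP perN] minN.
  exists (fun t => map letter (iter t evolution s)), N; split; split=> //.
  - move=> t; have [_ _ lt_t] := iter_evolution t lt_s.
    exact/Tinf_evolution.
  - by rewrite perN.
  - by move=> M M_gt0 /(inj_map letter_inj) perM; rewrite minN // M_gt0 perM /=.
move=> x N [x0 xS] [N_gt0 xN _] k /andP[k_gt0 le_k].
(* [Tinf_eq] is single-valued under strict majority, so every orbit consists of the iterates of
   [evolution]. *)
have def_x t : x t = map letter (iter t evolution s).
  elim: t => // t IHt; have [_ _ lt_t] := iter_evolution t lt_s.
  by apply/(Tinf_evolution _ lt_t); rewrite -IHt.
have perN : iter N evolution s = s.
  by apply: (inj_map letter_inj); rewrite -def_x.
have lt_k : k.-1 < size s by lia.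
have occ t : occupation k (x t) = nth false (iter t evolution s) k.-1.
  rewrite /occupation def_x (nth_map false); first by case: (nth _ _ _).
  by have [-> _ _] := iter_evolution t lt_s.
under eq_bigr => t _ do rewrite occ.
have := sum_nth_period lt_s perN lt_k; rewrite size_s weight_s => eqS.
have L_neq0 : (L%:R != 0 :> rat)%R by rewrite Num.Theory.pnatr_eq0; lia.
have N_neq0 : (N%:R != 0 :> rat)%R by rewrite Num.Theory.pnatr_eq0; lia.
rewrite -GRing.natr_sum; apply/eqP.
rewrite GRing.mulrC GRing.eqr_div //.
by rewrite -!GRing.natrM mulnC eqS mulnC.
Qed.
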